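(* Consider an RLC circuit with the data described in the context (connected circuit graph $G$, Hamiltonian $H$, conductance function $g$, source functions), and let $T$ be a spanning tree of $G$. Suppose: (A1) $B_{\mathcal V}$ has full row rank (there are no loops consisting of voltage sources only). (A2) The vertically stacked matrix $[B_{\mathcal C};\,B_{\mathcal L};\,B_{\mathcal R};\,B_{\mathcal V}]$ has full column rank (there are no cutsets consisting of current sources only). (A3) $H$ is a twice continuously differentiable function of the vector $q$ of capacitor charges, and the Hessian $\partial^2H/\partial q^2$ is symmetric positive definite at every point. (A4) $H$ is a twice continuously differentiable function of the vector $\phi$ of inductor fluxes, and the Hessian $\partial^2H/\partial\phi^2$ is symmetric positive definite at every point. (A5) The conductance function $g$ is a continuously differentiable function of the vector of resistor voltages, and its Jacobian is symmetric positive definite at every point. (A6) Among all spanning trees of $G$, $T$ has the most possible edges that are capacitors or voltage sources, and the fewest possible edges that are inductors or current sources. Then the CpH DAE $f(t,x,\dot x)=0$ defined by the circuit and $T$ is SA-amenable.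
   Context: **Circuit.** $^*$ denotes transpose. $G$ is a finite connected directed graph with edges $1,\dots,m$ and $n$ nodes. Its incidence matrix $A$ is $m\times n$, with $a_{ij}=+1$ if $j$ is the start node of edge $i$, $-1$ if $j$ is its end node, and $0$ otherwise. $B$ is the reduced incidence matrix, i.e. $A$ with one column (a grounded node) deleted. Each edge carries exactly one element: capacitor, inductor, resistor, voltage source or current source. The corresponding sets of edge indices are $\mathcal C,\mathcal L,\mathcal R,\mathcal V,\mathcal I$, a partition of $\{1,\dots,m\}$. $B_{\mathcal C}$ is the submatrix of $B$ consisting of the rows in $\mathcal C$, and similarly for the other types. Semicolons denote vertical stacking. **Element data.** The Hamiltonian $H$ is a real-valued function that is the sum of a function of the vector $q$ of capacitor charges only and a function of the vector $\phi$ of inductor fluxes only. The conductance function $g$ maps the vector of resistor voltages to the vector of resistor currents. Each voltage source $e$ has a given function $V_e(t)$, each current source $e$ a given function $I_e(t)$. **State variables.** $x=(x_1,\dots,x_m)$, where $x_e$ is the charge if $e\in\mathcal C$, the flux if $e\in\mathcal L$, the voltage across $e$ if $e\in\mathcal R$, the current through $e$ if $e\in\mathcal V$, and the voltage across $e$ if $e\in\mathcal I$. **Constitutive equations.** The edge voltages $\nu_e$ and edge currents $\iota_e$ are the following functions of $t,x,\dot x$: - $e\in\mathcal C$: $\nu_e=\partial H/\partial x_e$, $\iota_e=\dot x_e$; - $e\in\mathcal L$: $\nu_e=\dot x_e$, $\iota_e=\partial H/\partial x_e$; - $e\in\mathcal R$: $\nu_e=x_e$, $\iota_e=g_e(x_{\mathcal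 R})$; - $e\in\mathcal V$: $\nu_e=V_e(t)$, $\iota_e=x_e$; - $e\in\mathcal I$: $\nu_e=x_e$, $\iota_e=I_e(t)$. **CpH DAE.** A spanning tree $T$ is identified with its set of $n-1$ edge indices (twigs), and $N=\{1,\dots,m\}\setminus T$ is the cotree (links). The loop-cutset matrix is $F=-B_NB_T^{-1}$, where $B_T,B_N$ are the submatrices of rows of $B$ in $T$, $N$; its rows are indexed by $N$ and its columns by $T$. The CpH DAE is the system of $m$ equations $f(t,x,\dot x)=0$ in $x$, with one equation $f_e=0$ for each edge $e$, given by $$f_T=\iota_T-F^*\iota_N,\qquad f_N=\nu_N+F\nu_T .$$ **Structural analysis ($\Sigma$-method).** For a DAE $f_i=0$ in unknowns $x_j$ (equally many), the signature matrix $\Sigma=(\sigma_{ij})$ has $\sigma_{ij}$ equal to the order of the highest derivative of $x_j$ on which $f_i$ depends, or $-\infty$ if $f_i$ does not depend on $x_j$. A transversal is a set of positions with exactly one in each row and each column; its value is the sum of the $\sigma_{ij}$ over it. The DAE is structurally well-posed if some transversal has finite value. The canonical offsets are the (elementwise) smallest nonnegative integers $c_i,d_j$ such that $d_j-c_i\ge\sigma_{ij}$ everywhere, with equality on some transversal. The system Jacobian $\mathbf J$ has $\mathbf J_{ij}=\partial f_i/\partial x_j^{(d_j-c_i)}$ where $d_j-c_i\ge0$, and $\mathbf J_{ij}=0$ elsewhere. The DAE is SA-amenable if it is structurally well-posed and the system Jacobian defined by the canonical offsets is nonsingular. *)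

(* Defs.v *)
From HB Require Import structures.
From mathcomp Require Import all_boot all_order all_algebra all_fingroup.
From mathcomp Require Import all_classical all_reals all_analysis.
Import Order.TTheory GRing.Theory Num.Theory.
Import numFieldNormedType.Exports.

Set Implicit Arguments.
Unset Strict Implicit.
Unset Printing Implicit Defensive.

Local Open Scope ring_scope.

Section IndexSets.
Variables (R : realType) (m : nat).

(* [subrows A M] keeps the rows of [M] whose index lies in [A], in increasing
   order; [scatter A u] puts the entries of [u] back at the indices in [A] and
   is 0 elsewhere (its sum has at most one term). *)
Definition subrows (A : {set 'I_m}) p (M : 'M[R]_(m, p)) : 'M[R]_(#|A|, p) :=
  rowsub (fun i : 'I_#|A| => enum_val i) M.

Definition scatter (A : {set 'I_m}) (u : 'cV[R]_#|A|) : 'cV[R]_m :=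
  \col_e \sum_(i < #|A| | enum_val i == e) u i 0.

End IndexSets.

Section Smoothness.
Variables (R : realType) (n : nat).
Implicit Type h : 'cV[R]_n -> R.

Definition partial (i : 'I_n) h : 'cV[R]_n -> R := 'D_(delta_mx i 0) h.

Definition C1 h : Prop := forall i : 'I_n,
  (forall q, derivable h q (delta_mx i 0)) /\ continuous (partial i h).

Definition C2 h : Prop := C1 h /\ forall i : 'I_n, C1 (partial i h).

Definition hessian h (q : 'cV[R]_n) : 'M[R]_n :=
  \matrix_(i, j) partial i (partial j h) q.

(* The library's ['J] is for row vectors, with the transposed convention. *)
Definition jac k (g : 'cV[R]_n -> 'cV[R]_k) (u : 'cV[R]_n) : 'M[R]_(k, n) :=
  \matrix_(i, j) partial j (fun w => g w i 0) u.

Definition sym_posdef (M : 'M[R]_n) : Prop :=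
  M^T = M /\ forall u : 'cV[R]_n, u != 0 -> 0 < (u^T *m M *m u) 0 0.

End Smoothness.

(* A DAE of order at most [p] with as many equations as unknowns; column [k]
   of the argument of type ['M[R]_(m, p.+1)] holds the [k]-th time derivatives
   of the unknowns. *)
Definition dae (R : realType) (m p : nat) := R -> 'M[R]_(m, p.+1) -> 'cV[R]_m.

Section StructuralAnalysis.
Variables (R : realType) (m p : nat) (f : dae R m p).

Definition depends_on (i j : 'I_m) (k : 'I_p.+1) : Prop :=
  exists t X a, f t (X + a *: delta_mx j k) i 0 <> f t X i 0.

Definition signature (i j : 'I_m) : \bar int :=
  \big[maxe/-oo%E]_(k < p.+1 | `[< depends_on i j k >]) ((k : nat)%:Z)%:E.

(* A permutation [s] encodes the transversal [{(i, s i)}]. *)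
Definition transversal_value (s : 'S_m) : \bar int :=
  (\sum_(i < m) signature i (s i))%E.

Definition structurally_well_posed : Prop :=
  exists s : 'S_m, transversal_value s \is a fin_num.

Definition offset_diff (c d : 'I_m -> nat) (i j : 'I_m) : int :=
  (d j)%:Z - (c i)%:Z.

Definition valid_offsets (c d : 'I_m -> nat) : Prop :=
  (forall i j, (signature i j <= (offset_diff c d i j)%:E)%E) /\
  exists s : 'S_m, forall i, signature i (s i) = (offset_diff c d i (s i))%:E.

Definition canonical_offsets (c d : 'I_m -> nat) : Prop :=
  valid_offsets c d /\
  forall c' d' : 'I_m -> nat, valid_offsets c' d' ->
    (forall i, (c i <= c' i)%N) /\ (forall j, (d j <= d' j)%N).

(* Each sum has at most one term, [k = d j - c i]; it is empty when
   [d j < c i], and also when [d j - c i > p], where the partial derivative is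
   0 since [f] does not involve derivatives of order greater than [p]. *)
Definition system_jacobian (c d : 'I_m -> nat) (t : R) (X : 'M[R]_(m, p.+1)) :
    'M[R]_m :=
  \matrix_(i, j) \sum_(k < p.+1 | d j == (c i + k)%N)
    'D_(delta_mx j k) (fun Y : 'M[R]_(m, p.+1) => f t Y i 0) X.

(* Canonical offsets are unique when they exist. *)
Definition SA_amenable : Prop :=
  structurally_well_posed /\
  exists c d : 'I_m -> nat, canonical_offsets c d /\
    forall t X, system_jacobian c d t X \in unitmx.

End StructuralAnalysis.

Variant element := Capacitor | Inductor | Resistor | VoltageSource | CurrentSource.

Definition element_code (k : element) : 'I_5 :=
  match k with
  | Capacitor => inord 0 | Inductor => inord 1 | Resistor => inord 2
  | VoltageSource => inord 3 | CurrentSource => inord 4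
  end.

Definition element_decode (i : 'I_5) : element :=
  match nat_of_ord i with
  | 0 => Capacitor | 1 => Inductor | 2 => Resistor
  | 3 => VoltageSource | _ => CurrentSource
  end%N.

Lemma element_codeK : cancel element_code element_decode.
Proof. by case; rewrite /element_decode inordK. Qed.

HB.instance Definition _ := Finite.copy element (can_type element_codeK).

Definition edges_of m (elt : 'I_m -> element) (k : element) : {set 'I_m} :=
  [set e | elt e == k].

(* Parallel edges and self-loops are allowed; the grounded node makes the node
   set nonempty. The Hamiltonian is [hamC] of the charges plus [hamL] of the
   fluxes. *)
Record circuit (R : realType) (m n : nat) := Circuit {
  start : 'I_m -> 'I_n;
  stop : 'I_m -> 'I_n;
  ground : 'I_n;
  elt : 'I_m -> element;
  hamC : 'cV[R]_#|edges_of elt Capacitor| -> R;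
  hamL : 'cV[R]_#|edges_of elt Inductor| -> R;
  conductance : 'cV[R]_#|edges_of elt Resistor| ->
                'cV[R]_#|edges_of elt Resistor|;
  vsource : 'I_#|edges_of elt VoltageSource| -> R -> R;
  isource : 'I_#|edges_of elt CurrentSource| -> R -> R
}.

Arguments hamC {R m n} _ _.
Arguments hamL {R m n} _ _.
Arguments conductance {R m n} _ _.
Arguments vsource {R m n} _ _ _.
Arguments isource {R m n} _ _ _.

Section Circuit.
Variables (R : realType) (m n : nat) (G : circuit R m n).

Definition capE := edges_of (elt G) Capacitor.
Definition indE := edges_of (elt G) Inductor.
Definition resE := edges_of (elt G) Resistor.
Definition vsrcE := edges_of (elt G) VoltageSource.
Definition isrcE := edges_of (elt G) CurrentSource.

Definition adjacent (S : {set 'I_m}) : rel 'I_n := fun u v =>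
  [exists e in S, ((start G e == u) && (stop G e == v))
               || ((start G e == v) && (stop G e == u))].

Definition connected_by (S : {set 'I_m}) : Prop :=
  forall u v : 'I_n, connect (adjacent S) u v.

Definition circuit_connected : Prop := connected_by [set: 'I_m].

(* A cycle through [e] is a path between the ends of [e] avoiding [e]. *)
Definition acyclic (S : {set 'I_m}) : Prop :=
  forall e, e \in S -> ~~ connect (adjacent (S :\ e)) (start G e) (stop G e).

Definition spanning_tree (T : {set 'I_m}) : Prop := connected_by T /\ acyclic T.

(* +1 at the start node, -1 at the end node; a self-loop has a zero row. *)
Definition incidence : 'M[R]_(m, n) :=
  \matrix_(e, v) ((start G e == v)%:R - (stop G e == v)%:R).

Definition reduced_incidence : 'M[R]_(m, n.-1) := col' (ground G) incidence.

Local Notation B := reduced_incidence.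

(* [pinvmx] because [B_T] is only propositionally square; see [tree_mulmxV]
   and [tree_mulVmx]. *)
Definition loop_cutset (T : {set 'I_m}) : 'M[R]_(#|~: T|, #|T|) :=
  - (subrows (~: T) B *m pinvmx (subrows T B)).

Definition hamiltonian (x : 'cV[R]_m) : R :=
  hamC G (subrows capE x) + hamL G (subrows indE x).

Definition edge_voltage (t : R) (x x' : 'cV[R]_m) : 'cV[R]_m :=
  \col_e match elt G e with
         | Capacitor => partial e hamiltonian x
         | Inductor => x' e 0
         | Resistor => x e 0
         | VoltageSource => scatter (\col_i vsource G i t) e 0
         | CurrentSource => x e 0
         end.

Definition edge_current (t : R) (x x' : 'cV[R]_m) : 'cV[R]_m :=
  \col_e match elt G e with
         | Capacitor => x' e 0
         | Inductor => partial e hamiltonian x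
         | Resistor => scatter (conductance G (subrows resE x)) e 0
         | VoltageSource => x e 0
         | CurrentSource => scatter (\col_i isource G i t) e 0
         end.

Definition CpH_twig (T : {set 'I_m}) (t : R) (x x' : 'cV[R]_m) : 'cV[R]_#|T| :=
  let iota := edge_current t x x' in
  subrows T iota - (loop_cutset T)^T *m subrows (~: T) iota.

Definition CpH_link (T : {set 'I_m}) (t : R) (x x' : 'cV[R]_m) :
    'cV[R]_#|~: T| :=
  let nu := edge_voltage t x x' in
  subrows (~: T) nu + loop_cutset T *m subrows T nu.

Definition CpH (T : {set 'I_m}) : dae R m 1 := fun t X =>
  let x := col 0 X in
  let x' := col 1 X in
  scatter (CpH_twig T t x x') + scatter (CpH_link T t x x').

Lemma adjacent_sym S : symmetric (adjacent S).
Proof. by move=> u v; apply: eq_existsb => e; rewrite orbC. Qed.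

Lemma incidence_mul (x : 'cV[R]_n) e :
  (incidence *m x) e 0 = x (start G e) 0 - x (stop G e) 0.
Proof.
rewrite mxE; under eq_bigr do rewrite mxE mulrBl.
rewrite sumrB (bigD1 (start G e)) //= eqxx mul1r big1 ?addr0; last first.
  by move=> v /negPf; rewrite eq_sym => ->; rewrite mul0r.
rewrite (bigD1 (stop G e)) //= eqxx mul1r big1 ?addr0 //.
by move=> v /negPf; rewrite eq_sym => ->; rewrite mul0r.
Qed.

Lemma connect_start e (S : {set 'I_m}) u : e \in S ->
  connect (adjacent S) u (start G e) = connect (adjacent S) u (stop G e).
Proof.
move=> eS; apply: (same_connect_r (sym_connect_sym (@adjacent_sym S))).
by apply: connect1; apply/existsP; exists e; rewrite eS !eqxx.
Qed.

Lemma incidence_reduced (x : 'cV[R]_n) :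
  incidence *m x = B *m (\col_i (x (lift (ground G) i) 0 - x (ground G) 0)).
Proof.
have sum_lift (h : 'I_n) (F : 'I_n -> R) :
    \sum_j F j = F h + \sum_(i < n.-1) F (lift h i).
  by case: n h F => [[]//|n' h F]; rewrite (bigD1_ord h).
apply/colP => e; rewrite incidence_mul.
pose x0 : 'cV[R]_n := \col_j (x j 0 - x (ground G) 0).
have -> : x (start G e) 0 - x (stop G e) 0 = (incidence *m x0) e 0.
  by rewrite incidence_mul !mxE opprB addrA subrK.
rewrite mxE (sum_lift (ground G)) !mxE subrr mulr0 add0r.
by apply: eq_bigr => i _; rewrite !mxE.
Qed.

Lemma subrows_mul (S : {set 'I_m}) p q (M : 'M[R]_(m, p)) (N : 'M[R]_(p, q)) :
  subrows S (M *m N) = subrows S M *m N.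
Proof. by apply/matrixP => i j; rewrite !mxE; apply: eq_bigr => k _; rewrite mxE. Qed.

Lemma tree_row_full T : connected_by T -> row_full (subrows T B).
Proof.
move=> cT; rewrite -[row_full _]/(\rank _ == n.-1) -mxrank_tr.
rewrite -[_ == _]/(row_free _) -kermx_eq0.
apply/rowV0P => v /sub_kermxP /(congr1 trmx).
rewrite trmx_mul trmxK trmx0 => Bv0.
pose x : 'cV[R]_n :=
  \col_j (if unlift (ground G) j is Some i then v 0 i else 0).
have xg : x (ground G) 0 = 0 by rewrite mxE unlift_none.
have xl i : x (lift (ground G) i) 0 = v 0 i by rewrite mxE liftK.
have Ax0 : subrows T (incidence *m x) = 0.
  rewrite incidence_reduced subrows_mul -[RHS]Bv0; congr (_ *m _).
  by apply/colP => i; rewrite mxE xg xl subr0 mxE.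
have xE e : e \in T -> x (start G e) 0 = x (stop G e) 0.
  move=> eT; apply/eqP; rewrite -subr_eq0 -incidence_mul.
  move/colP/(_ (enum_rank_in eT e)) : Ax0.
  by rewrite [LHS]mxE [RHS]mxE enum_rankK_in // => ->.
have xc u w : connect (adjacent T) u w -> x u 0 = x w 0.
  move=> /connectP[s]; elim: s u => [|y s IHs] u /= => [_ -> //|].
  case/andP => /existsP[e /andP[/xE E Euy]] /IHs{}IHs /IHs <-.
  by case/orP: Euy => /andP[/eqP <- /eqP <-].
by apply/rowP => i; rewrite -xl (xc _ (ground G)) ?cT // xg mxE.
Qed.

Lemma tree_row_free T : acyclic T -> row_free (subrows T B).
Proof.
move=> aT; rewrite -kermx_eq0; apply/rowV0P => w /sub_kermxP wB0.
apply/rowP => i0; rewrite mxE; set e0 := enum_val i0.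
have e0T : e0 \in T by exact: enum_valP.
pose x : 'cV[R]_n :=
  \col_v (connect (adjacent (T :\ e0)) (start G e0) v)%:R.
have := congr1 (fun M : 'M[R]_(1, 1) => M 0 0)
  (mulmxA w (subrows T B) (\col_i (x (lift (ground G) i) 0 - x (ground G) 0))).
rewrite wB0 mul0mx -subrows_mul -incidence_reduced [RHS]mxE [LHS]mxE.
rewrite (bigD1 i0) //= big1 => [|i ii0]; rewrite [subrows _ _ _ _]mxE incidence_mul !mxE.
  by rewrite connect0 (negPf (aT _ e0T)) subr0 mulr1 addr0.
rewrite (@connect_start (enum_val i)) ?subrr ?mulr0 //.
by rewrite !inE enum_valP andbT; apply: contra ii0 => /eqP/enum_val_inj ->.
Qed.

Lemma tree_mulmxV T : spanning_tree T ->
  subrows T B *m pinvmx (subrows T B) = 1%:M.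
Proof. by case=> _ /tree_row_free; exact: mulmxVp. Qed.

Lemma tree_mulVmx T : spanning_tree T ->
  pinvmx (subrows T B) *m subrows T B = 1%:M.
Proof. by case=> /tree_row_full + _; exact: mulVpmx. Qed.

End Circuit.

(* Main.v *)
Require Import Defs.
From HB Require Import structures.
From mathcomp Require Import all_boot all_order all_algebra all_fingroup.
From mathcomp Require Import all_classical all_reals all_analysis.
From mathcomp Require Import zify.
Import Order.TTheory GRing.Theory Num.Theory.
Import numFieldNormedType.Exports.
Local Open Scope ring_scope.

Set Implicit Arguments.
Unset Strict Implicit.
Unset Printing Implicit Defensive.

(** Offsets can be written down without computing the signature matrix:
    [d_e = 1] for the charges and fluxes and [d_e = 0] for the other unknowns;
    [c_e = 1] for the links that are capacitors or voltage sources and for the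
    twigs that are inductors or current sources, [c_e = 0] for the other edges.
    The canonical offsets may be different, but this does not matter: all valid
    offsets are tight on the same transversals, so the nonzero terms in the
    Leibniz expansion of the system Jacobian are the same for all of them, and
    so is its determinant ([det_system_jacobian_valid]). It is therefore enough
    that these offsets satisfy [d_j - c_i >= sigma_ij] and give a nonsingular
    Jacobian; a nonzero term of its determinant then supplies the tight
    transversal ([SA_amenable_of_nonsingular]).

    Both facts rest on the block triangular form of the loop-cutset matrix. Let
    the stage of an edge be 0 for capacitors and voltage sources, 1 for
    resistors, 2 for inductors and current sources. If [F_lt <> 0] then
    exchanging the twig [t] for the link [l] gives another spanning tree, so the
    optimality of [T] forces [stage t <= stage l] ([link_coef_stage]). In
    particular the equation of a link of stage 0 only involves voltages of stage
    0, and the equation of a twig of stage 2 only involves currents of stage 2: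
    these equations contain no derivative and no unknown but charges or fluxes,
    which gives the inequality for [c] and [d] ([respects_CpH]).

    A vector [z] in the kernel of the Jacobian can be read as a perturbation of
    the state: it induces edge currents [a] and edge voltages [b] which, up to
    contributions of the other stages, satisfy the two Kirchhoff laws within
    each stage. Where those contributions vanish, Tellegen's theorem
    ([stage_tellegen]) says that the power [sum a_e b_e] over the stage is zero.
    For stage 1 the power is the quadratic form of the conductance Jacobian at
    the resistor part of [z], which is therefore zero. This removes the
    contributions of the resistors to the other stages, where sources carry no
    power, and the Hessians kill the capacitor and inductor parts. What is left
    is a current flowing in voltage sources only and a voltage supported by
    current sources only; these vanish because there is no loop of voltage
    sources and no cutset of current sources ([CpH_linearization_injective]). *)

(** * Directional derivatives *)

Section DirectionalDerivatives.
Variables (R : realType) (U V : normedModType R).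

(** Dependence in the signature matrix is defined by increments, not by
    derivatives; this is the bridge from the former to the latter. *)
Lemma is_derive_indep (f : U -> R) (x v : U) :
  (forall a : R, f (a *: v + x) = f x) -> is_derive x v f 0.
Proof.
move=> fE.
have E : (fun h : R => h^-1 *: ((f \o shift x) (h *: v) - f x)) = cst 0.
  by apply/funext => h /=; rewrite fE subrr scaler0.
apply: DeriveDef; first by rewrite /derivable E; exact: is_cvg_cst.
by rewrite /derive E lim_cst.
Qed.

Lemma eq_derive_increment (f : U -> R) (g : V -> R) (x v : U) (y w : V) :
  (forall a : R, f (a *: v + x) - f x = g (a *: w + y) - g y) ->
  'D_v f x = 'D_w g y.
Proof.
move=> fgE; rewrite /derive.
suff -> : (fun h : R => h^-1 *: ((f \o shift x) (h *: v) - f x))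
        = (fun h : R => h^-1 *: ((g \o shift y) (h *: w) - g y)) by [].
by apply/funext => h /=; rewrite fgE.
Qed.

(** Only the behaviour of [L] along one line matters, so that the inner map may
    be an extraction of coordinates and [g] need only have the one directional
    derivative, as under [C1]. *)
Lemma is_derive_comp_direction (g : V -> R) (L : U -> V) (x v : U) (w : V) :
  (forall a : R, L (a *: v + x) = a *: w + L x) ->
  derivable g (L x) w -> is_derive x v (g \o L) ('D_w g (L x)).
Proof.
move=> LE dg.
have E : (fun h : R => h^-1 *: (((g \o L) \o shift x) (h *: v) - (g \o L) x))
       = (fun h : R => h^-1 *: ((g \o shift (L x)) (h *: w) - g (L x))).
  by apply/funext => h /=; rewrite LE.
by apply: DeriveDef; rewrite /derivable /derive E.
Qed.

Lemma is_derive_lincomb (I : finType) (P : pred I) (c : I -> R)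
    (f : I -> U -> R) (df : I -> R) (x v : U) :
  (forall i, is_derive x v (f i) (df i)) ->
  is_derive x v (fun y => \sum_(i | P i) c i * f i y)
                (\sum_(i | P i) c i * df i).
Proof.
move=> fP.
have -> : (fun y => \sum_(i | P i) c i * f i y)
        = \sum_(i | P i) (c i *: f i : U -> R).
  by apply/funext => y; rewrite fct_sumE.
elim/big_rec2: _ => [|i df' f' _ f'P]; first exact: is_derive_cst.
exact: is_deriveD.
Qed.

End DirectionalDerivatives.

(** * Valid offsets and the system Jacobian *)

Section Offsets.
Variables (R : realType) (m p : nat) (f : dae R m p).
Implicit Types (c d : 'I_m -> nat) (s : 'S_m).

Lemma signature_leP i j (z : int) :
  reflect (forall k : 'I_p.+1, depends_on f i j k -> ((k : nat)%:Z <= z))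
          (signature f i j <= z%:E)%E.
Proof.
apply: (iffP (bigmax_leP _ _ _ _)) => [[_ sz] k /asboolT/sz|sz].
  by rewrite lee_fin.
by split=> [|k /asboolW/sz]; rewrite ?leNye ?lee_fin.
Qed.

(** A nonzero entry of the Jacobian is a partial derivative of order
    [d j - c i] that does not vanish, hence witnesses a dependence. *)
Lemma system_jacobian_neq0 c d t X i j :
  system_jacobian f c d t X i j != 0 ->
  ((offset_diff c d i j)%:E <= signature f i j)%E.
Proof.
rewrite mxE => J0.
have [k /andP[/eqP djE Dk]] : exists k : 'I_p.+1, (d j == (c i + k)%N) &&
    ('D_(delta_mx j k) (fun Y : 'M[R]_(m, p.+1) => f t Y i 0) X != 0).
  apply/existsP; apply: contraNT J0 => /existsPn D0.
  by rewrite big1 // => k djE; move: (D0 k); rewrite djE negbK => /eqP.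
have dep : depends_on f i j k.
  apply: contrapT => ndep; move/eqP: Dk; apply.
  suff /@derive_val : is_derive X (delta_mx j k)
      (fun Y : 'M[R]_(m, p.+1) => f t Y i 0) 0 by [].
  apply: is_derive_indep => a; rewrite addrC; apply: contrapT => fN.
  by apply: ndep; exists t, X, a.
rewrite /offset_diff djE PoszD addrC addKr.
exact: (le_bigmax_cond _ (fun k : 'I_p.+1 => ((k : nat)%:Z)%:E) (asboolT dep)).
Qed.

Definition tight c d s :=
  forall i, signature f i (s i) = (offset_diff c d i (s i))%:E.

Lemma sum_offset_diff c d s :
  \sum_i offset_diff c d i (s i) = \sum_j (d j)%:Z - \sum_i (c i)%:Z.
Proof.
by rewrite sumrB [in RHS](reindex_inj (@perm_inj _ s)).
Qed.

(** Linear programming duality for the assignment problem. The sum of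
    [d j - c i] over a transversal does not depend on the transversal, and tight
    transversals show that it is the same for both pairs of offsets, namely the
    highest value of a transversal. On [s], which reaches it, the termwise
    inequality given by validity of the second pair is thus an equality. *)
Lemma valid_tight_diff c d c' d' s : valid_offsets f c d ->
  valid_offsets f c' d' -> tight c d s ->
  forall i, offset_diff c d i (s i) = offset_diff c' d' i (s i).
Proof.
move=> [leS _] [leS' [s' s'T]] sT.
have le1 i : offset_diff c d i (s i) <= offset_diff c' d' i (s i).
  by rewrite -lee_fin -sT leS'.
have le2 i : offset_diff c' d' i (s' i) <= offset_diff c d i (s' i).
  by rewrite -lee_fin -s'T leS.
have : \sum_i (offset_diff c' d' i (s i) - offset_diff c d i (s i)) == 0.
  rewrite eq_le sumr_ge0 ?andbT => [|i _]; last by rewrite subr_ge0.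
  rewrite sumrB subr_le0 !sum_offset_diff -(sum_offset_diff c' d' s').
  by rewrite -(sum_offset_diff c d s') ler_sum.
rewrite psumr_eq0 => [/allP eq0 i|i _]; last by rewrite subr_ge0.
by apply/eqP; rewrite eq_sym -subr_eq0; apply: eq0; exact: mem_index_enum.
Qed.

(** The product over a transversal that is not tight vanishes for either pair
    of offsets; over a tight one the differences [d j - c i] agree, so both
    products involve the same partial derivatives. *)
Lemma det_system_jacobian_valid c d c' d' t X : valid_offsets f c d ->
  valid_offsets f c' d' ->
  \det (system_jacobian f c d t X) = \det (system_jacobian f c' d' t X).
Proof.
move=> vcd vcd'; apply: eq_bigr => s _; congr (_ * _).
have tightP c1 d1 : valid_offsets f c1 d1 ->
    \prod_i system_jacobian f c1 d1 t X i (s i) != 0 -> tight c1 d1 s.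
  move=> [leS _] /prodf_neq0 J0 i.
  by apply/eqP; rewrite eq_le leS (system_jacobian_neq0 (J0 i _)).
have eqJ : (forall i, offset_diff c d i (s i) = offset_diff c' d' i (s i)) ->
    \prod_i system_jacobian f c d t X i (s i)
    = \prod_i system_jacobian f c' d' t X i (s i).
  move=> dE; apply: eq_bigr => i _; rewrite !mxE; apply: eq_bigl => k.
  by have := dE i; rewrite /offset_diff => dEi; apply/eqP/eqP; lia.
have [P0|/(tightP _ _ vcd) sT] :=
    eqVneq (\prod_i system_jacobian f c d t X i (s i)) 0.
  have [P0'|/(tightP _ _ vcd') sT] :=
      eqVneq (\prod_i system_jacobian f c' d' t X i (s i)) 0.
    by rewrite P0 P0'.
  by apply: eqJ => i; rewrite (valid_tight_diff vcd' vcd sT).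
exact/eqJ/(valid_tight_diff vcd vcd' sT).
Qed.

(** As in any system of difference constraints, the inequalities survive minima;
    a tight transversal of one pair is tight for the other, which keeps the
    equalities. *)
Lemma valid_offsets_min c d c' d' : valid_offsets f c d ->
  valid_offsets f c' d' ->
  valid_offsets f (fun i => minn (c i) (c' i)) (fun j => minn (d j) (d' j)).
Proof.
move=> vcd vcd'; case: (vcd) (vcd') => [leS [s sT]] [leS' _]; split=> [i j|].
  have [le_dd'|lt_d'd] := leqP (d j) (d' j).
    apply: (le_trans (leS i j)); rewrite lee_fin /offset_diff; lia.
  apply: (le_trans (leS' i j)); rewrite lee_fin /offset_diff; lia.
exists s => i; rewrite sT; congr (_%:E).
have := valid_tight_diff vcd vcd' sT i.
by rewrite /offset_diff; lia.
Qed.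

(** Offsets of least total sum are the least ones: their minimum with any other
    valid offsets is valid and has no smaller sum, so it changes nothing. *)
Lemma canonical_offsets_exist c d : valid_offsets f c d ->
  exists c' d', canonical_offsets f c' d'.
Proof.
move=> vcd.
pose P k := `[< exists c1 d1, valid_offsets f c1 d1 /\
                 (\sum_i c1 i + \sum_j d1 j)%N = k >].
have exP : exists k, P k.
  by exists (\sum_i c i + \sum_j d j)%N; apply/asboolP; exists c, d.
case: (ex_minnP exP) => k /asboolP[c1 [d1 [v1 <-]]] kmin.
exists c1, d1; split=> // c2 d2 v2.
have := kmin _ (asboolT (ex_intro _ _ (ex_intro _ _
  (conj (valid_offsets_min v1 v2) erefl)))).
set c3 := fun i => minn (c1 i) (c2 i); set d3 := fun i => minn (d1 i) (d2 i).
have sum_min (a b : 'I_m -> nat) :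
    (\sum_i minn (a i) (b i) <= \sum_i a i
       ?= iff [forall i, minn (a i) (b i) == a i])%N.
  by apply: leqif_sum => i _; split=> //; exact: geq_minl.
have [lec eqc] := sum_min c1 c2; have [led eqd] := sum_min d1 d2.
move=> min_sum; split=> i; apply/minn_idPl/eqP; move: i; apply/forallP.
  by rewrite -eqc; lia.
by rewrite -eqd; lia.
Qed.

Lemma SA_amenable_of_valid_offsets c d : valid_offsets f c d ->
  (forall t X, system_jacobian f c d t X \in unitmx) -> SA_amenable f.
Proof.
move=> vcd Junit; split.
  case: (vcd) => _ [s sT]; exists s; rewrite /transversal_value.
  by under eq_bigr do rewrite sT; rewrite sumEFin.
have [c' [d' cd'P]] := canonical_offsets_exist vcd.
exists c', d'; split=> // t X.
case: cd'P => v' _.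
by rewrite unitmxE -(det_system_jacobian_valid t X vcd v') -unitmxE.
Qed.

(** No tight transversal has to be exhibited: nonsingularity at one point gives
    a permutation along which all entries of the Jacobian are nonzero. *)
Lemma SA_amenable_of_nonsingular c d :
  (forall i j, (signature f i j <= (offset_diff c d i j)%:E)%E) ->
  (forall t X, system_jacobian f c d t X \in unitmx) -> SA_amenable f.
Proof.
move=> leS Junit; apply: SA_amenable_of_valid_offsets (Junit); split=> //.
have := Junit 0 0; rewrite unitmxE unitfE => /eqP det0.
have [s Ps] : exists s : 'S_m, \prod_i system_jacobian f c d 0 0 i (s i) != 0.
  apply: contrapT => noS; apply: det0; apply: big1 => s _.
  apply/eqP; rewrite mulf_eq0; apply/orP; right; apply: contrapT => /negP Ps.
  by apply: noS; exists s.
exists s => i; move/prodf_neq0: Ps => /(_ i isT)/system_jacobian_neq0 geS.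
by apply/eqP; rewrite eq_le leS geS.
Qed.

End Offsets.

(** * Exchanging edges of a spanning tree *)

Section Exchange.
Variables (R : realType) (m n : nat) (G : circuit R m n).
Local Notation B := (reduced_incidence G).
Implicit Types (S T : {set 'I_m}) (e l t : 'I_m).

Lemma ex_enum_val (A : {set 'I_m}) e :
  e \in A -> exists i : 'I_#|A|, e = enum_val i.
Proof. by move=> eA; exists (enum_rank_in eA e); rewrite enum_rankK_in. Qed.

Lemma row_full_of_ker k p (M : 'M[R]_(k, p)) :
  (forall y : 'cV_p, M *m y = 0 -> y = 0) -> row_full M.
Proof.
move=> kerM; rewrite -[row_full _]/(\rank _ == p) -mxrank_tr.
rewrite -[_ == _]/(row_free _) -kermx_eq0.
apply/rowV0P => v /sub_kermxP /(congr1 trmx).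
rewrite trmx_mul trmxK trmx0 => /kerM/(congr1 trmx).
by rewrite trmxK trmx0.
Qed.

(** If [v] is not reachable from [u] through [S], the indicator of the component
    of [u] is a potential that is constant along the edges in [S] but not
    constant. *)
Lemma row_full_connected S : row_full (subrows S B) -> connected_by G S.
Proof.
move=> fullB u v; apply: contraT => nuv.
pose x : 'cV[R]_n := \col_w (connect (Defs.adjacent G S) u w)%:R.
have Bx0 : subrows S B *m
    (\col_i (x (lift (ground G) i) 0 - x (ground G) 0)) = 0.
  rewrite -subrows_mul -incidence_reduced; apply/colP => i.
  rewrite [LHS]mxE incidence_mul !mxE.
  by rewrite (@connect_start _ _ _ _ (enum_val i)) ?subrr // enum_valP.
have x_ground w : x w 0 = x (ground G) 0.
  have [->//|[i ->]] : w = ground G \/ exists i, w = lift (ground G) i.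
    by case: (unliftP (ground G) w) => [i|] ->; [right; exists i|left].
  rewrite -[RHS]add0r; apply/eqP; rewrite -subr_eq; apply/eqP.
  rewrite -(mulmx0 _ (subrows S B)) in Bx0.
  by have /colP/(_ i) := row_full_inj fullB Bx0; rewrite !mxE.
have := x_ground v; rewrite -(x_ground u) !mxE connect0 (negPf nuv) => /eqP.
by rewrite eq_sym oner_eq0.
Qed.

Lemma spanning_tree_card T : spanning_tree G T -> #|T| = n.-1.
Proof.
by case=> /(tree_row_full (G := G))/eqP <- /(tree_row_free (G := G))/eqP.
Qed.

(** An edge on a cycle could be removed without losing connectedness, leaving
    [n - 2] rows of rank [n - 1]. *)
Lemma connected_acyclic S : connected_by G S -> #|S| = n.-1 -> acyclic G S.
Proof.
move=> cS cardS e eS; apply/negP => ce.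
have symS1 := sym_connect_sym (@adjacent_sym _ _ _ G (S :\ e)).
have /(tree_row_full (G := G))/eqP rS1 : connected_by G (S :\ e).
  move=> u v; apply: (connect_sub _ (cS u v)) => {}u {}v.
  case/existsP=> a /andP[aS auv].
  have [ae|nae] := eqVneq a e; last first.
    by apply: connect1; apply/existsP; exists a; rewrite !inE nae aS.
  move: auv; rewrite ae => /orP[]/andP[/eqP <- /eqP <-] //.
  by rewrite symS1.
have := rank_leq_row (subrows (S :\ e) B); rewrite rS1 -cardS (cardsD1 e S) eS.
by rewrite ltnn.
Qed.

(** The loop-cutset matrix indexed by the edges themselves; it is 0 outside
    links times twigs. *)
Definition link_coef T l t : R :=
  \sum_(i < #|~: T| | enum_val i == l) \sum_(j < #|T| | enum_val j == t)
    loop_cutset G T i j.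

Lemma link_coefE T i j :
  link_coef T (enum_val i) (enum_val j) = loop_cutset G T i j.
Proof.
rewrite /link_coef (eq_bigl (pred1 i)) => [|k]; last first.
  by rewrite (inj_eq enum_val_inj).
rewrite big_pred1_eq (eq_bigl (pred1 j)) => [|k]; last first.
  by rewrite (inj_eq enum_val_inj).
by rewrite big_pred1_eq.
Qed.

(** The defining property [B_N = - F B_T] of the loop-cutset matrix. *)
Lemma link_row T l k : spanning_tree G T -> l \notin T ->
  B l k = - \sum_(t in T) link_coef T l t * B t k.
Proof.
move=> tT; rewrite -finset.in_setC => /ex_enum_val[i ->].
have : subrows (~: T) B = - (loop_cutset G T *m subrows T B).
  by rewrite mulNmx opprK -mulmxA (tree_mulVmx tT) mulmx1.
move/matrixP/(_ i k); rewrite [LHS]mxE => ->.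
rewrite mxE [in LHS]mxE; congr (- _).
rewrite [RHS]big_enum_val.
by apply: eq_bigr => j _; rewrite link_coefE; congr (_ * _); rewrite mxE.
Qed.

(** Kirchhoff's voltage law: the voltages [B y] of a potential [y]. *)
Lemma link_potential T l (y : 'cV_n.-1) : spanning_tree G T -> l \notin T ->
  (B *m y) l 0 = - \sum_(t in T) link_coef T l t * (B *m y) t 0.
Proof.
move=> tT lT; rewrite !mxE.
under eq_bigr do rewrite (link_row _ tT lT) mulNr mulr_suml.
rewrite sumrN exchange_big; congr (- _); apply: eq_bigr => t _ /=.
by rewrite !mxE mulr_sumr; apply: eq_bigr => k _; rewrite mulrA.
Qed.

(** A potential that is constant along the new tree has voltage 0 on [l] and on
    all the old twigs but [t]; the relation of [l] to the twigs, where [t] has a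
    nonzero coefficient, then makes the voltage of [t] vanish as well. *)
Lemma spanning_tree_exchange T l t : spanning_tree G T -> l \notin T ->
  t \in T -> link_coef T l t != 0 -> spanning_tree G (l |: T :\ t).
Proof.
move=> tT lT tinT F0.
have cT' : connected_by G (l |: T :\ t).
  apply: row_full_connected; apply: row_full_of_ker => y.
  rewrite -subrows_mul => /colP By0.
  have {}By0 e : e \in l |: T :\ t -> (B *m y) e 0 = 0.
    by case/ex_enum_val => i ->; have := By0 i; rewrite [LHS]mxE => ->;
      rewrite mxE.
  have Byt : (B *m y) t 0 = 0.
    have /eqP := link_potential y tT lT; rewrite By0 ?finset.setU11 //.
    rewrite eq_sym oppr_eq0 (bigD1 t) //= big1 => [|s /andP[sT st]]; last first.
      by rewrite By0 ?mulr0 // !inE st sT orbT.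
    by rewrite addr0 mulf_eq0 (negPf F0) => /eqP.
  apply: (row_full_inj (tree_row_full tT.1)); rewrite mulmx0 -subrows_mul.
  apply/colP => i; rewrite [LHS]mxE [RHS]mxE.
  have [->//|it] := eqVneq (enum_val i) t.
  by rewrite By0 // !inE it enum_valP orbT.
split=> //; apply: connected_acyclic => //.
rewrite -(spanning_tree_card tT) cardsU1 (cardsD1 t T) tinT !inE.
by rewrite (negPf lT) andbF.
Qed.

(** An optimal spanning tree takes the edges of low stage first. *)
Definition stage (k : element) : nat :=
  match k with
  | Capacitor | VoltageSource => 0
  | Resistor => 1
  | Inductor | CurrentSource => 2
  end.

(** Exchanging [t] for [l] must neither increase the number of capacitors and
    voltage sources nor decrease that of inductors and current sources. *)
Lemma link_coef_stage T l t : spanning_tree G T ->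
  (forall T' : {set 'I_m}, spanning_tree G T' ->
    (#|T' :&: (capE G :|: vsrcE G)| <= #|T :&: (capE G :|: vsrcE G)|)%N /\
    (#|T :&: (indE G :|: isrcE G)| <= #|T' :&: (indE G :|: isrcE G)|)%N) ->
  l \notin T -> t \in T -> link_coef T l t != 0 ->
  (stage (elt G t) <= stage (elt G l))%N.
Proof.
move=> tT optT lT tinT F0.
have [leCV leLI] := optT _ (spanning_tree_exchange tT lT tinT F0).
have CV_E e : (e \in capE G :|: vsrcE G) = (stage (elt G e) == 0%N).
  rewrite !inE; apply/orP/eqP => [[]/eqP -> //|].
  by case: (elt G e) => // _; rewrite eqxx; [left|right].
have LI_E e : (e \in indE G :|: isrcE G) = (stage (elt G e) == 2%N).
  rewrite !inE; apply/orP/eqP => [[]/eqP -> //|].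
  by case: (elt G e) => // _; rewrite eqxx; [left|right].
have lCV : stage (elt G l) == 0%N -> stage (elt G t) == 0%N.
  move=> l0; apply: contraTT leCV => t0; rewrite -ltnNge.
  have -> : (l |: T :\ t) :&: (capE G :|: vsrcE G)
          = l |: (T :&: (capE G :|: vsrcE G)).
    apply/finset.setP => e; rewrite finset.in_setI finset.in_setU1.
    rewrite finset.in_setD1 finset.in_setU1 finset.in_setI CV_E.
    have [->|_] //= := eqVneq e l; have [->|_] //= := eqVneq e t.
    by rewrite (negPf t0) andbF.
  by rewrite cardsU1 finset.in_setI (negPf lT).
have tLI : stage (elt G t) == 2%N -> stage (elt G l) == 2%N.
  move=> t2; apply: contraTT leLI => l2; rewrite -ltnNge.
  have -> : (l |: T :\ t) :&: (indE G :|: isrcE G)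
          = (T :&: (indE G :|: isrcE G)) :\ t.
    apply/finset.setP => e; rewrite finset.in_setI finset.in_setU1.
    rewrite !finset.in_setD1 finset.in_setI LI_E.
    by have [->|_] //= := eqVneq e l; rewrite ?(negPf l2) ?andbF // andbA.
  by rewrite [ltnRHS](cardsD1 t) finset.in_setI tinT LI_E t2.
by move: lCV tLI; case: (elt G l); case: (elt G t) => //=;
  first [by move/(_ isT) | by move=> _ /(_ isT)].
Qed.

End Exchange.

(** * Linearization along the leading derivatives *)

Section Linearization.
Variables (R : realType) (m : nat).
Local Notation state := ('M[R]_(m, 2)).
Implicit Types (A : {set 'I_m}) (X : state) (z : 'cV[R]_m) (d : 'I_m -> nat).

Lemma scatter_enum_val A (u : 'cV[R]_#|A|) i : scatter u (enum_val i) 0 = u i 0.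
Proof.
rewrite mxE (eq_bigl (pred1 i)) ?big_pred1_eq // => k.
by rewrite (inj_eq enum_val_inj).
Qed.

Lemma scatter_notin A (u : 'cV[R]_#|A|) e : e \notin A -> scatter u e 0 = 0.
Proof.
move=> eA; rewrite mxE big_pred0 // => i.
by apply: contraNF eA => /eqP <-; exact: enum_valP.
Qed.

Lemma subrows_delta A i (a : R) (x : 'cV[R]_m) :
  subrows A (a *: delta_mx (enum_val i) 0 + x) =
  a *: delta_mx i 0 + subrows A x.
Proof. by apply/colP => b; rewrite !mxE (inj_eq enum_val_inj). Qed.

Lemma subrows_delta_notin A e (a : R) (x : 'cV[R]_m) : e \notin A ->
  subrows A (a *: delta_mx e 0 + x) = subrows A x.
Proof.
move=> eA; apply/colP => b; rewrite !mxE.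
case: eqP => [be|_]; last by rewrite mulr0 add0r.
by rewrite -be enum_valP in eA.
Qed.

Lemma col_delta (k : 'I_2) j (a : R) X :
  col k (a *: delta_mx j k + X) = a *: delta_mx j 0 + col k X.
Proof. by apply/colP => b; rewrite !mxE eqxx. Qed.

Lemma col_delta_neq (k k' : 'I_2) j (a : R) X : k != k' ->
  col k (a *: delta_mx j k' + X) = col k X.
Proof.
by move=> kk'; apply/colP => b; rewrite !mxE (negPf kk') andbF mulr0 add0r.
Qed.

(** The nonlinear edge laws depend on the undifferentiated unknowns of a single
    type of element. *)
Definition substate_fun A (g : 'cV[R]_#|A| -> R) : state -> R :=
  fun X => g (subrows A (col 0 X)).

Lemma is_derive_coord X e (k0 : 'I_2) j k :
  is_derive X (delta_mx j k) (fun Y : state => Y e k0)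
            ((e == j) && (k0 == k))%:R.
Proof.
have := is_derive_comp_direction (g := (@id R)) (L := fun Y : state => Y e k0)
  (x := X) (v := delta_mx j k) (w := ((e == j) && (k0 == k))%:R).
rewrite derive_id; apply; last exact: derivable_id.
by move=> a; rewrite !mxE.
Qed.

Lemma is_derive_substate A (g : 'cV[R]_#|A| -> R) X j k :
  (forall i q, derivable g q (delta_mx i 0)) ->
  is_derive X (delta_mx j k) (substate_fun g)
    (if k == 0 then
       scatter (\col_i partial i g (subrows A (col 0 X))) j 0 else 0).
Proof.
move=> dg; have [->|k0] := eqVneq k 0; last first.
  by apply: is_derive_indep => a; rewrite /substate_fun col_delta_neq // eq_sym.
have [/ex_enum_val[i ->]|jA] := boolP (j \in A).
  rewrite scatter_enum_val mxE.
  apply: (@is_derive_comp_direction _ _ _ g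
    (fun Y : state => subrows A (col 0 Y)) X) => // a.
  by rewrite col_delta subrows_delta.
rewrite scatter_notin //; apply: is_derive_indep => a.
by rewrite /substate_fun col_delta subrows_delta_notin.
Qed.

(** The differential at [X] applied to [z], where the partial derivative of
    [phi] with respect to the unknown [j] is taken at order [d j - c] only: a
    row of the system Jacobian times [z], for an equation [phi] of offset [c].
    Unlike that row, it makes sense for each of the terms of [phi] separately. *)
Definition linearize d z X (c : nat) (phi : state -> R) : R :=
  \sum_j \sum_(k < 2 | d j == (c + k)%N) 'D_(delta_mx j k) phi X * z j 0.

(** [phi] does not depend on derivatives of any unknown [j] of order above
    [d j - c]. *)
Definition respects d (c : nat) (phi : state -> R) : Prop :=
  forall X a j (k : 'I_2), (d j < c + k)%N ->
    phi (X + a *: delta_mx j k) = phi X.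

Definition smooth (phi : state -> R) : Prop :=
  forall X j k, derivable phi X (delta_mx j k).

Lemma smooth_coord e k0 : smooth (fun Y => Y e k0).
Proof. by move=> X j k; case: (is_derive_coord X e k0 j k). Qed.

Lemma smooth_cst (r : R) : smooth (fun=> r).
Proof. by move=> X j k; exact: derivable_cst. Qed.

Lemma smooth_substate A (g : 'cV[R]_#|A| -> R) :
  (forall i q, derivable g q (delta_mx i 0)) -> smooth (substate_fun g).
Proof. by move=> dg X j k; case: (is_derive_substate X j k dg). Qed.

Lemma linearize_cst d z X c (r : R) : linearize d z X c (fun=> r) = 0.
Proof.
rewrite /linearize big1 // => j _; rewrite big1 // => k _.
by rewrite derive_cst mul0r.
Qed.

Lemma linearize_coord d z X c e k0 :
  linearize d z X c (fun Y => Y e k0) = if d e == (c + k0)%N then z e 0 else 0.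
Proof.
rewrite /linearize (bigD1 e) //= [X in _ + X]big1 ?addr0 => [|j je]; last first.
  apply: big1 => k _; have /@derive_val -> := is_derive_coord X e k0 j k.
  by rewrite eq_sym (negPf je) mul0r.
under eq_bigr => k _.
  have /@derive_val -> := is_derive_coord X e k0 e k.
  rewrite eqxx /= mulr_natl mulrb; over.
rewrite -big_mkcondr /=; case: ifP => de.
  rewrite (big_pred1 k0) // => k /=; rewrite [k == k0]eq_sym.
  by have [<-|] := eqVneq k0 k; rewrite ?de ?andbF.
by rewrite big_pred0 // => k; have [<-|] := eqVneq k0 k; rewrite ?de ?andbF.
Qed.

(** With a common offset [dA] of the unknowns in [A], only the undifferentiated
    unknowns enter, so the linearization is the full differential of [g] when
    [c = dA] and 0 otherwise. *)
Lemma linearize_substate d z X c A (g : 'cV[R]_#|A| -> R) (dA : nat) :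
  (forall i q, derivable g q (delta_mx i 0)) ->
  (forall e, e \in A -> d e = dA) ->
  linearize d z X c (substate_fun g) =
  if dA == c then \sum_i partial i g (subrows A (col 0 X)) * z (enum_val i) 0
  else 0.
Proof.
move=> dg dAE; rewrite /linearize.
have E j : \sum_(k < 2 | d j == (c + k)%N)
    'D_(delta_mx j k) (substate_fun g) X * z j 0 =
    if (j \in A) && (dA == c) then
      scatter (\col_i partial i g (subrows A (col 0 X))) j 0 * z j 0 else 0.
  under eq_bigr => k _ do have /@derive_val -> := is_derive_substate X j k dg.
  rewrite big_mkcond big_ord_recl big_ord1 /= mul0r addn0 if_same addr0.
  have [jA|jA] := boolP (j \in A); first by rewrite dAE.
  by rewrite scatter_notin // mul0r if_same.
under eq_bigr do rewrite E.
rewrite -big_mkcond /= big_mkcondr /= big_enum_val.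
case: eqP => // _; last by rewrite big1.
by apply: eq_bigr => i _; rewrite scatter_enum_val mxE.
Qed.

Lemma linearize_lincomb d z X c (P : pred 'I_m) (phi : state -> R)
    (r : 'I_m -> R) (psi : 'I_m -> state -> R) :
  smooth phi -> (forall e, smooth (psi e)) ->
  linearize d z X c (fun Y => phi Y + \sum_(e | P e) r e * psi e Y) =
  linearize d z X c phi + \sum_(e | P e) r e * linearize d z X c (psi e).
Proof.
move=> sphi spsi; rewrite /linearize.
under [X in _ = _ + X]eq_bigr do rewrite mulr_sumr.
rewrite [X in _ = _ + X]exchange_big /= -big_split /=; apply: eq_bigr => j _.
under [X in _ = _ + X]eq_bigr do rewrite mulr_sumr.
rewrite [X in _ = _ + X]exchange_big /= -big_split /=; apply: eq_bigr => k _.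
have Dphi := derivableP (sphi X j k).
have Dpsi e := derivableP (spsi e X j k).
have /@derive_val -> := is_deriveD Dphi (is_derive_lincomb P r Dpsi).
rewrite mulrDl mulr_suml; congr (_ + _).
by apply: eq_bigr => e _; rewrite mulrA.
Qed.

Lemma respects_coord d c e (k0 : 'I_2) : (c + k0 <= d e)%N ->
  respects d c (fun Y => Y e k0).
Proof.
move=> cd X a j k dj; rewrite !mxE.
have [ej|_] := eqVneq e j; last by rewrite mulr0 addr0.
have [k0k|_] := eqVneq k0 k; last by rewrite mulr0 addr0.
by move: dj; rewrite -ej -k0k ltnNge cd.
Qed.

Lemma respects_cst d c (r : R) : respects d c (fun=> r).
Proof. by []. Qed.

Lemma respects_substate d c A (g : 'cV[R]_#|A| -> R) :
  (forall e, e \in A -> (c <= d e)%N) -> respects d c (substate_fun g).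
Proof.
move=> cd X a j k dj; rewrite /substate_fun addrC.
have [k0|k0] := eqVneq k 0; last by rewrite col_delta_neq // eq_sym.
rewrite k0 col_delta subrows_delta_notin //; rewrite k0 addn0 in dj.
by apply: contraL dj => /cd; rewrite -leqNgt.
Qed.

Lemma respects_lincomb d c (P : pred 'I_m) (phi : state -> R)
    (r : 'I_m -> R) (psi : 'I_m -> state -> R) :
  respects d c phi -> (forall e, P e -> r e != 0 -> respects d c (psi e)) ->
  respects d c (fun Y => phi Y + \sum_(e | P e) r e * psi e Y).
Proof.
move=> rphi rpsi X a j k dj; rewrite rphi //; congr (_ + _).
apply: eq_bigr => e Pe; have [->|re] := eqVneq (r e) 0; first by rewrite !mul0r.
by rewrite (rpsi e).
Qed.

Lemma signature_respects (f : dae R m 1) c d i j :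
  (forall t, respects d (c i) (fun X => f t X i 0)) ->
  (signature f i j <= (offset_diff c d i j)%:E)%E.
Proof.
move=> rf; apply/signature_leP => k [t [X [a fN]]].
rewrite /offset_diff; have [dj|] := ltnP (d j) (c i + k); last by lia.
by case: fN; exact: (rf t X a j k dj).
Qed.

Lemma system_jacobian_mulmx (f : dae R m 1) c d t X z i :
  (system_jacobian f c d t X *m z) i 0 =
  linearize d z X (c i) (fun Y => f t Y i 0).
Proof. by rewrite mxE; apply: eq_bigr => j _; rewrite mxE mulr_suml. Qed.

End Linearization.

(** * Edge voltages and currents as functions of the state *)

Section BranchFunctions.
Variables (R : realType) (m n : nat) (G : circuit R m n).
Local Notation state := ('M[R]_(m, 2)).
Implicit Types (T : {set 'I_m}) (t : R) (e l s : 'I_m) (X : state).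

Definition voltage t e : state -> R :=
  fun X => edge_voltage G t (col 0 X) (col 1 X) e 0.

Definition current t e : state -> R :=
  fun X => edge_current G t (col 0 X) (col 1 X) e 0.

Lemma partial_hamiltonian_C i (x : 'cV[R]_m) :
  partial (enum_val i) (hamiltonian G) x =
  partial i (hamC G) (subrows (capE G) x).
Proof.
have iL : enum_val i \notin indE G.
  by have := enum_valP i; rewrite !inE => /eqP ->; apply/eqP.
apply: eq_derive_increment => a.
rewrite /hamiltonian subrows_delta subrows_delta_notin //.
by rewrite opprD addrACA subrr addr0.
Qed.

Lemma partial_hamiltonian_L i (x : 'cV[R]_m) :
  partial (enum_val i) (hamiltonian G) x =
  partial i (hamL G) (subrows (indE G) x).
Proof.
have iC : enum_val i \notin capE G.
  by have := enum_valP i; rewrite !inE => /eqP ->; apply/eqP.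
apply: eq_derive_increment => a.
rewrite /hamiltonian subrows_delta subrows_delta_notin //.
by rewrite opprD addrACA subrr add0r.
Qed.

Lemma voltage_C t i :
  voltage t (enum_val i) = substate_fun (partial i (hamC G)).
Proof.
apply/funext => X; rewrite /voltage mxE.
have := enum_valP i; rewrite inE => /eqP ->.
exact: partial_hamiltonian_C.
Qed.

Lemma current_L t i :
  current t (enum_val i) = substate_fun (partial i (hamL G)).
Proof.
apply/funext => X; rewrite /current mxE.
have := enum_valP i; rewrite inE => /eqP ->.
exact: partial_hamiltonian_L.
Qed.

Lemma current_R t i :
  current t (enum_val i) = substate_fun (fun u => conductance G u i 0).
Proof.
apply/funext => X; rewrite /current mxE.
have := enum_valP i; rewrite inE => /eqP ->.
exact: scatter_enum_val.
Qed.

Lemma voltageE t e : elt G e != Capacitor ->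
  voltage t e = match elt G e with
    | Inductor => fun X => X e 1
    | VoltageSource => fun=> scatter (\col_i vsource G i t) e 0
    | _ => fun X => X e 0
    end.
Proof.
move=> eC; apply/funext => X; rewrite /voltage mxE.
by case: (elt G e) eC; rewrite ?eqxx // => _; rewrite mxE.
Qed.

Lemma currentE t e : elt G e != Inductor -> elt G e != Resistor ->
  current t e = match elt G e with
    | Capacitor => fun X => X e 1
    | CurrentSource => fun=> scatter (\col_i isource G i t) e 0
    | _ => fun X => X e 0
    end.
Proof.
move=> eL eR; apply/funext => X; rewrite /current mxE.
by case: (elt G e) eL eR; rewrite ?eqxx // => _ _; rewrite mxE.
Qed.

Lemma CpH_twigE T t X e : e \in T ->
  CpH G T t X e 0 = current t e X +
    \sum_(l | l \notin T) - link_coef G T l e * current t l X.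
Proof.
move=> eT; rewrite /CpH mxE [X in _ + X]scatter_notin ?inE ?eT // addr0.
case/ex_enum_val: eT => i ->.
rewrite scatter_enum_val /CpH_twig mxE [X in X + _ = _]mxE; congr (_ + _).
rewrite mxE [in LHS]mxE -sumrN.
rewrite (eq_bigl (fun l => l \in ~: T)) => [|l]; last by rewrite inE.
rewrite [RHS]big_enum_val; apply: eq_bigr => j _.
by rewrite link_coefE mulNr mxE [X in _ * X]mxE.
Qed.

Lemma CpH_linkE T t X e : e \notin T ->
  CpH G T t X e 0 =
  voltage t e X + \sum_(s in T) link_coef G T e s * voltage t s X.
Proof.
move=> eT; rewrite /CpH mxE [X in X + _]scatter_notin // add0r.
move: eT; rewrite -finset.in_setC => /ex_enum_val[i ->].
rewrite scatter_enum_val /CpH_link mxE [X in X + _ = _]mxE; congr (_ + _).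
rewrite mxE [RHS]big_enum_val; apply: eq_bigr => j _.
by rewrite link_coefE; congr (_ * _); rewrite mxE.
Qed.

End BranchFunctions.

(** * Positive definite forms and Tellegen's theorem *)

Section Tellegen.
Variables (R : realType) (m : nat).

Lemma quadratic_form_sum k (M : 'M[R]_k) (u : 'cV[R]_k) :
  (u^T *m M *m u) 0 0 = \sum_i u i 0 * \sum_j M i j * u j 0.
Proof.
rewrite -mulmxA mxE; apply: eq_bigr => i _; rewrite !mxE.
by congr (_ * _); apply: eq_bigr => j _.
Qed.

Lemma sym_posdef_eq0 k (M : 'M[R]_k) (u : 'cV[R]_k) : sym_posdef M ->
  \sum_i u i 0 * \sum_j M i j * u j 0 = 0 -> u = 0.
Proof.
move=> [_ posM]; rewrite -quadratic_form_sum => uMu0.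
by apply/eqP; apply: contraT => /posM; rewrite uMu0 ltxx.
Qed.

(** [a] and [b] satisfy the two Kirchhoff laws of the subnetwork [P]. The twig
    part of the power is [sum F_lt a_l b_t] by the current law, and the link
    part is its opposite by the voltage law. *)
Lemma tellegen (T : {set 'I_m}) (P : pred 'I_m) (F : 'I_m -> 'I_m -> R)
    (a b : 'I_m -> R) :
  (forall t, t \in T -> P t ->
    a t = \sum_(l | (l \notin T) && P l) F l t * a l) ->
  (forall l, l \notin T -> P l ->
    b l = - \sum_(t | (t \in T) && P t) F l t * b t) ->
  \sum_(e | P e) a e * b e = 0.
Proof.
move=> aT bN; rewrite (bigID (mem T)) /=.
rewrite (eq_bigl (fun e => (e \in T) && P e)) => [|e]; last by rewrite andbC.
rewrite [X in _ + X](eq_bigl (fun e => (e \notin T) && P e)) => [|e];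
  last first.
  by rewrite andbC.
under eq_bigr => t /andP[tT Pt] do rewrite (aT t tT Pt) mulr_suml.
under [X in _ + X]eq_bigr => l /andP[lT Pl] do
  rewrite (bN l lT Pl) mulrN mulr_sumr.
rewrite exchange_big sumrN /= -sumrB big1 // => l _.
rewrite -sumrB big1 // => t _.
by rewrite mulrA (mulrC (a l)) subrr.
Qed.

End Tellegen.

(** * The linearized circuit *)

Section CircuitLinearization.
Variables (R : realType) (m n : nat) (G : circuit R m n).
Implicit Types (T : {set 'I_m}) (t : R) (e l s : 'I_m) (z : 'cV[R]_m).
Implicit Types X : 'M[R]_(m, 2).

Definition unknown_offset e : nat :=
  match elt G e with Capacitor | Inductor => 1 | _ => 0 end.

Definition equation_offset T e : nat :=
  if e \in T then stage (elt G e) == 2%N else stage (elt G e) == 0%N.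

Hypothesis hamC_C2 : C2 (hamC G).
Hypothesis hamL_C2 : C2 (hamL G).
Hypothesis conductance_C1 : forall i, C1 (fun u => conductance G u i 0).

Let derivC i j q : derivable (partial i (hamC G)) q (delta_mx j 0).
Proof. by case: hamC_C2 => _ /(_ i j)[]. Qed.

Let derivL i j q : derivable (partial i (hamL G)) q (delta_mx j 0).
Proof. by case: hamL_C2 => _ /(_ i j)[]. Qed.

Let derivR i j q : derivable (fun u => conductance G u i 0) q (delta_mx j 0).
Proof. by case: (conductance_C1 i j). Qed.

Let in_capE e : elt G e = Capacitor -> e \in capE G.
Proof. by rewrite inE => ->. Qed.

Let in_indE e : elt G e = Inductor -> e \in indE G.
Proof. by rewrite inE => ->. Qed.

Let in_resE e : elt G e = Resistor -> e \in resE G.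
Proof. by rewrite inE => ->. Qed.

Lemma smooth_voltage t e : smooth (voltage G t e).
Proof.
have [/in_capE/ex_enum_val[i ->]|eC] := eqVneq (elt G e) Capacitor.
  by rewrite voltage_C; exact: smooth_substate.
rewrite voltageE //; case: (elt G e); [ | | | exact: smooth_cst |];
  exact: smooth_coord.
Qed.

Lemma smooth_current t e : smooth (current G t e).
Proof.
have [/in_indE/ex_enum_val[i ->]|eL] := eqVneq (elt G e) Inductor.
  by rewrite current_L; exact: smooth_substate.
have [/in_resE/ex_enum_val[i ->]|eR] := eqVneq (elt G e) Resistor.
  rewrite current_R.
  exact: (smooth_substate (g := fun u => conductance G u i 0)).
rewrite currentE //; case: (elt G e); [ | | | | exact: smooth_cst];
  exact: smooth_coord.
Qed.

Lemma respects_voltage t e c : (c <= (stage (elt G e) == 0))%N ->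
  respects unknown_offset c (voltage G t e).
Proof.
have [eC|eC] := eqVneq (elt G e) Capacitor.
  rewrite eC => c1; have /ex_enum_val[i ->] := in_capE eC.
  rewrite voltage_C; apply: respects_substate => j.
  by rewrite inE /unknown_offset => /eqP ->.
move=> c1; rewrite voltageE //.
case Ee: (elt G e) c1 => c1; [ | | | exact: respects_cst |];
  by apply: respects_coord; rewrite /unknown_offset Ee; case: c c1 => [|[]].
Qed.

Lemma respects_current t e c : (c <= (stage (elt G e) == 2))%N ->
  respects unknown_offset c (current G t e).
Proof.
have [eL|eL] := eqVneq (elt G e) Inductor.
  rewrite eL => c1; have /ex_enum_val[i ->] := in_indE eL.
  rewrite current_L; apply: respects_substate => j.
  by rewrite inE /unknown_offset => /eqP ->.
have [eR|eR] := eqVneq (elt G e) Resistor.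
  rewrite eR leqn0 => /eqP ->; have /ex_enum_val[i ->] := in_resE eR.
  rewrite current_R.
  exact: (@respects_substate _ _ _ _ _ (fun u => conductance G u i 0)).
move=> c1; rewrite currentE //.
case Ee: (elt G e) c1 => c1; [ | | | | exact: respects_cst];
  by apply: respects_coord; rewrite /unknown_offset Ee; case: c c1 => [|[]].
Qed.

Local Notation lin z X c phi := (linearize unknown_offset z X c phi).

Lemma lin_voltage_C z X t i c :
  lin z X c (voltage G t (enum_val i)) =
  if 1%N == c then \sum_j hessian (hamC G) (subrows (capE G) (col 0 X)) j i
                     * subrows (capE G) z j 0 else 0.
Proof.
rewrite voltage_C (@linearize_substate _ _ _ _ _ _ _ _ 1%N) => [|//|e];
  last first.
  by rewrite inE /unknown_offset => /eqP ->.
by case: ifP => // _; apply: eq_bigr => j _; rewrite !mxE.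
Qed.

Lemma lin_current_L z X t i c :
  lin z X c (current G t (enum_val i)) =
  if 1%N == c then \sum_j hessian (hamL G) (subrows (indE G) (col 0 X)) j i
                     * subrows (indE G) z j 0 else 0.
Proof.
rewrite current_L (@linearize_substate _ _ _ _ _ _ _ _ 1%N) => [|//|e];
  last first.
  by rewrite inE /unknown_offset => /eqP ->.
by case: ifP => // _; apply: eq_bigr => j _; rewrite !mxE.
Qed.

Lemma lin_current_R z X t i :
  lin z X 0 (current G t (enum_val i)) =
  \sum_j jac (conductance G) (subrows (resE G) (col 0 X)) i j
         * subrows (resE G) z j 0.
Proof.
rewrite current_R (@linearize_substate _ _ _ _ _ _ _
  (fun u => conductance G u i 0) 0%N) => [|//|e]; last first.
  by rewrite inE /unknown_offset => /eqP ->.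
by apply: eq_bigr => j _; rewrite !mxE.
Qed.

Lemma lin_voltage z X t e :
  lin z X 0 (voltage G t e) =
  if stage (elt G e) == 0%N then 0 else z e 0.
Proof.
have [eC|eC] := eqVneq (elt G e) Capacitor.
  by rewrite eC; have /ex_enum_val[i ->] := in_capE eC; rewrite lin_voltage_C.
rewrite voltageE //.
case Ee: (elt G e) eC => eC; rewrite ?eqxx // in eC;
  by rewrite ?linearize_cst ?linearize_coord /unknown_offset ?Ee.
Qed.

Lemma lin_current z X t e : elt G e != Resistor ->
  lin z X 0 (current G t e) =
  if stage (elt G e) == 0%N then z e 0 else 0.
Proof.
have [eL|eL] := eqVneq (elt G e) Inductor => eR.
  by rewrite eL; have /ex_enum_val[i ->] := in_indE eL; rewrite lin_current_L.
rewrite currentE //.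
case Ee: (elt G e) eL eR => eL eR; rewrite ?eqxx // in eL eR;
  by rewrite ?linearize_cst ?linearize_coord /unknown_offset ?Ee.
Qed.

Lemma lin_voltage_V z X t e c :
  elt G e = VoltageSource -> lin z X c (voltage G t e) = 0.
Proof.
by move=> eV; rewrite voltageE eV ?linearize_cst //; apply/eqP.
Qed.

Lemma lin_current_I z X t e c :
  elt G e = CurrentSource -> lin z X c (current G t e) = 0.
Proof.
by move=> eI; rewrite currentE eI ?linearize_cst //; apply/eqP.
Qed.

Lemma linearize_twig T z X t c e : e \in T ->
  lin z X c (fun Y => CpH G T t Y e 0) =
  lin z X c (current G t e) -
    \sum_(l | l \notin T) link_coef G T l e * lin z X c (current G t l).
Proof.
move=> eT.
have -> : (fun Y => CpH G T t Y e 0) = fun Y => current G t e Y +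
    \sum_(l | l \notin T) - link_coef G T l e * current G t l Y.
  by apply/funext => Y; rewrite CpH_twigE.
rewrite linearize_lincomb; [|exact: smooth_current|exact: smooth_current].
by rewrite -sumrN; congr (_ + _); apply: eq_bigr => l _; rewrite mulNr.
Qed.

Lemma linearize_link T z X t c e : e \notin T ->
  lin z X c (fun Y => CpH G T t Y e 0) =
  lin z X c (voltage G t e) +
    \sum_(s in T) link_coef G T e s * lin z X c (voltage G t s).
Proof.
move=> eT.
have -> : (fun Y => CpH G T t Y e 0) = fun Y => voltage G t e Y +
    \sum_(s in T) link_coef G T e s * voltage G t s Y.
  by apply/funext => Y; rewrite CpH_linkE.
by rewrite linearize_lincomb; [|exact: smooth_voltage|exact: smooth_voltage].
Qed.

Variable T : {set 'I_m}.
Hypothesis T_tree : spanning_tree G T.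
Hypothesis F_stage : forall l s, l \notin T -> s \in T ->
  link_coef G T l s != 0 -> (stage (elt G s) <= stage (elt G l))%N.

Local Notation F := (link_coef G T).
Local Notation stg e := (stage (elt G e)).

(** An equation of offset 1 is that of a link of stage 0 or of a twig of stage
    2. By the block form of [F] it involves only voltages of edges of stage 0,
    or only currents of edges of stage 2, and these are functions of time and of
    the charges, respectively of the fluxes. For the equations of offset 0 it is
    enough that only charges and fluxes are differentiated. *)
Lemma respects_CpH t e :
  respects unknown_offset (equation_offset T e) (fun X => CpH G T t X e 0).
Proof.
rewrite /equation_offset; have [eT|eT] := boolP (e \in T).
  have -> : (fun Y => CpH G T t Y e 0) = fun Y => current G t e Y +
      \sum_(l | l \notin T) - F l e * current G t l Y.
    by apply/funext => Y; rewrite CpH_twigE.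
  apply: respects_lincomb => [|l lT]; first exact: respects_current.
  rewrite oppr_eq0 => /(F_stage lT eT) le_el; apply: respects_current.
  by case: eqP le_el => // ->; case: (elt G l).
have -> : (fun Y => CpH G T t Y e 0) = fun Y => voltage G t e Y +
    \sum_(s in T) F e s * voltage G t s Y.
  by apply/funext => Y; rewrite CpH_linkE.
apply: respects_lincomb => [|s sT]; first exact: respects_voltage.
move=> /(F_stage eT sT) le_se; apply: respects_voltage.
by case: eqP le_se => // ->; rewrite leqn0 => ->.
Qed.

Lemma twig_sum_stage (a : 'I_m -> R) s : s \in T ->
  (forall l, (stg s < stg l)%N -> a l = 0) ->
  \sum_(l | l \notin T) F l s * a l =
  \sum_(l | (l \notin T) && (stg l == stg s)) F l s * a l.
Proof.
move=> sT a0; rewrite [RHS]big_mkcondr; apply: eq_bigr => l lT.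
case: eqVneq => // ne_ls; have [->|/(F_stage lT sT) le_sl] := eqVneq (F l s) 0.
  by rewrite mul0r.
by rewrite a0 ?mulr0 // ltn_neqAle eq_sym ne_ls.
Qed.

Lemma link_sum_stage (b : 'I_m -> R) l : l \notin T ->
  (forall s, (stg s < stg l)%N -> b s = 0) ->
  \sum_(s in T) F l s * b s =
  \sum_(s | (s \in T) && (stg s == stg l)) F l s * b s.
Proof.
move=> lT b0; rewrite [RHS]big_mkcondr; apply: eq_bigr => s sT.
case: eqVneq => // ne_sl; have [->|/(F_stage lT sT) le_sl] := eqVneq (F l s) 0.
  by rewrite mul0r.
by rewrite b0 ?mulr0 // ltn_neqAle ne_sl.
Qed.

(** The block form of [F] hides the links of lower stage from the twigs of stage
    [k], and the twigs of higher stage from the links of stage [k]; the two last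
    hypotheses deal with the other edges. *)
Lemma stage_tellegen k (a b : 'I_m -> R) :
  (forall s, s \in T -> stg s = k ->
    a s = \sum_(l | l \notin T) F l s * a l) ->
  (forall l, l \notin T -> stg l = k ->
    b l = - \sum_(s in T) F l s * b s) ->
  (forall l, (k < stg l)%N -> a l = 0) ->
  (forall s, (stg s < k)%N -> b s = 0) ->
  \sum_(e | stg e == k) a e * b e = 0.
Proof.
move=> aT bN a0 b0; apply: (@tellegen _ _ T _ F) => e eT /eqP ek.
  by rewrite -ek -twig_sum_stage ?ek //; exact: aT.
by rewrite -ek -link_sum_stage ?ek //; exact: bN.
Qed.

Lemma sum_stage k (K : element) (f : 'I_m -> R) : stage K = k ->
  (forall e, stg e = k -> elt G e != K -> f e = 0) ->
  \sum_(e | stg e == k) f e =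
  \sum_(i < #|edges_of (elt G) K|) f (enum_val i).
Proof.
move=> Kk f0; transitivity (\sum_(e in edges_of (elt G) K) f e); last first.
  exact: big_enum_val.
rewrite [LHS]big_mkcond [RHS]big_mkcond; apply: eq_bigr => e _.
rewrite inE; have [->|eK] := eqVneq (elt G e) K; first by rewrite Kk eqxx.
by case: eqP => // ek; rewrite f0.
Qed.

Hypothesis V_free : row_free (subrows (vsrcE G) (reduced_incidence G)).
Hypothesis CLRV_full :
  row_full (col_mx (subrows (capE G) (reduced_incidence G))
           (col_mx (subrows (indE G) (reduced_incidence G))
           (col_mx (subrows (resE G) (reduced_incidence G))
                   (subrows (vsrcE G) (reduced_incidence G))))).
Hypothesis hamC_posdef : forall q, sym_posdef (hessian (hamC G) q).
Hypothesis hamL_posdef : forall q, sym_posdef (hessian (hamL G) q).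
Hypothesis conductance_posdef : forall u, sym_posdef (jac (conductance G) u).

(** Stage 1 comes first, because the resistors appear in the current law of
    stage 0 and in the voltage law of stage 2. *)
Lemma CpH_linearization_injective z X t :
  (forall e, lin z X (equation_offset T e) (fun Y => CpH G T t Y e 0) = 0) ->
  z = 0.
Proof.
move=> Jz0.
pose a c e := lin z X c (current G t e).
pose b c e := lin z X c (voltage G t e).
have aT e : e \in T -> a (equation_offset T e) e =
    \sum_(l | l \notin T) F l e * a (equation_offset T e) l.
  by move=> eT; apply/eqP; rewrite -subr_eq0 -linearize_twig // Jz0.
have bN e : e \notin T -> b (equation_offset T e) e =
    - \sum_(s in T) F e s * b (equation_offset T e) s.
  by move=> eT; apply/eqP; rewrite -addr_eq0 -linearize_link // Jz0.
have aT0 e : e \in T -> (stg e < 2)%N ->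
    a 0%N e = \sum_(l | l \notin T) F l e * a 0%N l.
  by move=> eT e2; have := aT e eT; rewrite /equation_offset eT ltn_eqF.
have aT1 e : e \in T -> stg e = 2 ->
    a 1%N e = \sum_(l | l \notin T) F l e * a 1%N l.
  by move=> eT e2; have := aT e eT; rewrite /equation_offset eT e2.
have bN0 e : e \notin T -> (0 < stg e)%N ->
    b 0%N e = - \sum_(s in T) F e s * b 0%N s.
  by move=> eT e0; have := bN e eT; rewrite /equation_offset (negPf eT) gtn_eqF.
have bN1 e : e \notin T -> stg e = 0%N ->
    b 1%N e = - \sum_(s in T) F e s * b 1%N s.
  by move=> eT e0; have := bN e eT; rewrite /equation_offset (negPf eT) e0.
have b0E e : b 0%N e = if stg e == 0%N then 0 else z e 0 by exact: lin_voltage.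
have a0E e :
    elt G e != Resistor -> a 0%N e = if stg e == 0%N then z e 0 else 0.
  exact: lin_current.
have notR e : stg e != 1%N -> elt G e != Resistor.
  by apply: contraNneq => ->.
have a0_LI e : (1 < stg e)%N -> a 0%N e = 0.
  by move=> e2; rewrite a0E ?notR ?gtn_eqF //; exact: ltnW.
have sub_eq0 (A : {set 'I_m}) :
    subrows A z = 0 -> forall e, e \in A -> z e 0 = 0.
  move=> /colP zA e /ex_enum_val[i ->]; have := zA i.
  by rewrite [LHS]mxE [RHS]mxE.
have stgR e : stg e = 1%N -> elt G e = Resistor by case: (elt G e).
(* In equations of offset 0, edges of stage 2 carry no linearized current and
   edges of stage 0 no linearized voltage, so both Kirchhoff laws hold within
   stage 1. *)
have zR : subrows (resE G) z = 0.
  apply: (sym_posdef_eq0 (conductance_posdef (subrows (resE G) (col 0 X)))).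
  have := stage_tellegen (k := 1%N) (a := a 0%N) (b := b 0%N).
  rewrite (sum_stage (K := Resistor)) //; last first.
    by move=> e /stgR ->; rewrite eqxx.
  move=> P; rewrite -[RHS]P; last first.
  - by move=> s; rewrite ltnS leqn0 b0E => ->.
  - exact: a0_LI.
  - by move=> l lT l1; rewrite bN0 ?l1.
  - by move=> s sT s1; rewrite aT0 ?s1.
  apply: eq_bigr => i _; rewrite mulrC; congr (_ * _).
    by rewrite /a lin_current_R.
  have := enum_valP i; rewrite inE b0E => /eqP ->.
  by rewrite mxE.
have a0_R e : elt G e = Resistor -> a 0%N e = 0.
  move=> /in_resE/ex_enum_val[i ->]; rewrite /a lin_current_R zR.
  by rewrite big1 // => j _; rewrite [X in _ * X]mxE mulr0.
have a0_pos e : (0 < stg e)%N -> a 0%N e = 0.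
  by case: (ltngtP (stg e) 1) => [|/a0_LI|/stgR/a0_R] //; case: (stg e).
(* The voltage law of a link of stage 0 comes from an equation of offset 1 and
   the current law of a twig from one of offset 0, whence [a 0] against [b 1]. *)
have zC : subrows (capE G) z = 0.
  apply: (sym_posdef_eq0 (hamC_posdef (subrows (capE G) (col 0 X)))).
  have := stage_tellegen (k := 0%N) (a := a 0%N) (b := b 1%N).
  rewrite (sum_stage (K := Capacitor)) //; last first.
    move=> e e0 eC; rewrite /b lin_voltage_V ?mulr0 //.
    by case: (elt G e) e0 eC; rewrite ?eqxx.
  move=> P; rewrite -[RHS]P //; last first.
    by move=> s sT s0; rewrite aT0 ?s0.
  apply: eq_bigr => i _; congr (_ * _).
    rewrite a0E; have := enum_valP i; rewrite inE => /eqP ->; last exact/eqP.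
    by rewrite mxE.
  rewrite /b lin_voltage_C eqxx; apply: eq_bigr => j _; congr (_ * _).
  by rewrite -[in LHS](hamC_posdef _).1 mxE.
(* Dually, the twigs of stage 2 are those whose equation has offset 1. *)
have zL : subrows (indE G) z = 0.
  apply: (sym_posdef_eq0 (hamL_posdef (subrows (indE G) (col 0 X)))).
  have := stage_tellegen (k := 2%N) (a := a 1%N) (b := b 0%N).
  rewrite (sum_stage (K := Inductor)) //; last first.
    move=> e e2 eL; rewrite /a lin_current_I ?mul0r //.
    by case: (elt G e) e2 eL; rewrite ?eqxx.
  move=> P; rewrite -[RHS]P; last first.
  - move=> s; rewrite b0E; case: eqP => // s0 s2.
    apply: (sub_eq0 _ zR); apply/in_resE/stgR; lia.
  - by move=> l; case: (elt G l).
  - by move=> l lT l2; rewrite bN0 ?l2.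
  - by move=> s sT s2; rewrite aT1 ?s2.
  apply: eq_bigr => i _; rewrite mulrC; congr (_ * _).
    rewrite /a lin_current_L eqxx; apply: eq_bigr => j _; congr (_ * _).
    by rewrite -[in LHS](hamL_posdef _).1 mxE.
  have := enum_valP i; rewrite inE b0E => /eqP ->.
  by rewrite mxE.
(* A column of the incidence matrix is a family of voltages too, and [a 0] is
   now supported by the voltage sources. *)
have zV : subrows (vsrcE G) z = 0.
  apply: trmx_inj; apply: (row_free_inj V_free); rewrite trmx0 mul0mx.
  apply/rowP => k; rewrite [LHS]mxE [RHS]mxE.
  have := stage_tellegen (k := 0%N) (a := a 0%N)
    (b := fun e => reduced_incidence G e k).
  rewrite (sum_stage (K := VoltageSource)) //; last first.
    move=> e e0 eV; rewrite a0E ?notR ?e0 // (sub_eq0 _ zC) ?mul0r // inE.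
    by case: (elt G e) e0 eV; rewrite ?eqxx.
  move=> P; rewrite -[RHS]P //; last 2 first.
  - by move=> s sT s0; rewrite aT0 ?s0.
  - by move=> l lT _; exact: link_row.
  apply: eq_bigr => i _; congr (_ * _); last by rewrite mxE.
  rewrite a0E; have := enum_valP i; rewrite inE => /eqP ->; last exact/eqP.
  by rewrite !mxE.
have b0_CLRV e : elt G e != CurrentSource -> b 0%N e = 0.
  move=> eI; rewrite b0E; case: eqP => // e0.
  case Ee: (elt G e) e0 eI; rewrite ?eqxx // => _ _.
    exact/(sub_eq0 _ zL)/in_indE.
  exact/(sub_eq0 _ zR)/in_resE.
(* The voltages [b 0] derive from a potential [y] and are supported by the
   current sources: [y] is defined by the twigs, and links of lower stage get
   voltage 0 because they see no twig of stage 2. *)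
pose y := pinvmx (subrows T (reduced_incidence G)) *m
  (\col_i b 0%N (enum_val i)).
have By_T e : e \in T -> (reduced_incidence G *m y) e 0 = b 0%N e.
  case/ex_enum_val => i ->.
  have : subrows T (reduced_incidence G *m y) = \col_i b 0%N (enum_val i).
    by rewrite subrows_mul /y mulmxA tree_mulmxV // mul1mx.
  by move/colP/(_ i); rewrite [LHS]mxE [RHS]mxE.
have By e : (reduced_incidence G *m y) e 0 = b 0%N e.
  have [/By_T//|eT] := boolP (e \in T).
  rewrite (link_potential _ T_tree) //.
  under eq_bigr => s sT do rewrite By_T //.
  have [e2|e2] := ltnP (stg e) 2; last by rewrite -bN0 //; exact: ltnW.
  rewrite b0_CLRV; last by apply: contraTneq e2 => ->.
  rewrite big1 ?oppr0 // => s sT.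
  have [->|/(F_stage eT sT) le_se] := eqVneq (F e s) 0; first by rewrite mul0r.
  rewrite b0_CLRV ?mulr0 //; apply: contraTneq e2 => sI.
  by move: le_se; rewrite sI -leqNgt.
have By0 (K : element) : K != CurrentSource ->
    subrows (edges_of (elt G) K) (reduced_incidence G) *m y = 0.
  move=> KI; rewrite -subrows_mul; apply/colP => i.
  rewrite [LHS]mxE [RHS]mxE By.
  by apply: b0_CLRV; have := enum_valP i; rewrite inE => /eqP ->.
have y0 : y = 0.
  apply: (row_full_inj CLRV_full); rewrite mulmx0 !mul_col_mx.
  by rewrite !By0 ?col_mx0 //; apply/eqP.
have zI e : elt G e = CurrentSource -> z e 0 = 0.
  move=> eI; have := b0E e; rewrite eI /= => <-.
  by rewrite -By y0 mulmx0 mxE.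
apply/colP => e; rewrite [RHS]mxE.
case Ee: (elt G e).
- exact/(sub_eq0 _ zC)/in_capE.
- exact/(sub_eq0 _ zL)/in_indE.
- exact/(sub_eq0 _ zR)/in_resE.
- by apply: (sub_eq0 _ zV); rewrite inE Ee.
- exact: zI.
Qed.

End CircuitLinearization.

Theorem theorem3p1 (R : realType) (m n : nat) (G : circuit R m n)
    (T : {set 'I_m})
    (G_connected : circuit_connected G)
    (T_tree : spanning_tree G T)
    (A1 : row_free (subrows (vsrcE G) (reduced_incidence G)))
    (A2 : row_full (col_mx (subrows (capE G) (reduced_incidence G))
                   (col_mx (subrows (indE G) (reduced_incidence G))
                   (col_mx (subrows (resE G) (reduced_incidence G))
                           (subrows (vsrcE G) (reduced_incidence G))))))
    (A3 : C2 (hamC G) /\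
          forall q, sym_posdef (hessian (hamC G) q))
    (A4 : C2 (hamL G) /\
          forall phi, sym_posdef (hessian (hamL G) phi))
    (A5 : (forall i, C1 (fun u => conductance G u i 0)) /\
          forall u, sym_posdef (jac (conductance G) u))
    (A6 : forall T' : {set 'I_m}, spanning_tree G T' ->
          (#|T' :&: (capE G :|: vsrcE G)| <= #|T :&: (capE G :|: vsrcE G)|)%N /\
          (#|T :&: (indE G :|: isrcE G)| <= #|T' :&: (indE G :|: isrcE G)|)%N) :
  SA_amenable (CpH G T).
Proof.
have F_stage l s : l \notin T -> s \in T -> link_coef G T l s != 0 ->
    (stage (elt G s) <= stage (elt G l))%N.
  exact: link_coef_stage.
have [[A3d A3p] [A4d A4p] [A5d A5p]] := And3 A3 A4 A5.
apply: (SA_amenable_of_nonsingular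
  (c := equation_offset G T) (d := unknown_offset G)).
  by move=> i j; apply: signature_respects => t; exact: respects_CpH.
move=> t X; rewrite -row_full_unit; apply: row_full_of_ker => z Jz0.
apply: (CpH_linearization_injective A3d A4d A5d T_tree F_stage A1 A2 A3p A4p A5p
  (z := z) (X := X) (t := t)) => e.
by rewrite -system_jacobian_mulmx Jz0 mxE.
Qed.
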